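(* Let $G=(V,E)$ be a loop directed graph on $V=\{1,\dots,n\}$ in which every vertex has a loop, let $G_s=(V,E_s)$ be the simple directed graph obtained by removing all loops, and let $S=\{v_1,\dots,v_m\}\subseteq V$. Then the following are equivalent: (a) for every $A\in\mathcal{Q}_{ld}(G)$ and every $B\in\mathbf{B}(S)$ the matrix $[B\ AB\ \cdots\ A^{n-1}B]$ has rank $n$; (b) for every $A\in\mathcal{Q}_{sd}(G_s)$ and every $B\in\mathbf{B}(S)$ the matrix $[B\ AB\ \cdots\ A^{n-1}B]$ has rank $n$.
   Context: $\mathcal{Q}_{ld}(G)$ is the set of real $n\times n$ matrices $A$ with $a_{ij}\neq0$ iff $(j,i)\in E$ for all $i,j$ (so here all diagonal entries are nonzero). $\mathcal{Q}_{sd}(G_s)$ is the set of real $n\times n$ matrices $A$ with $a_{ij}\neq0$ iff $(j,i)\in E_s$ for all $i\neq j$, diagonal entries arbitrary (zero or nonzero). $\mathbf{B}(S)$ is the set of real $n\times m$ matrices $B$ with $B_{ij}\neq0$ iff $i=v_j$. *)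

(* Defs.v *)
From mathcomp Require Import all_boot all_order all_algebra.
From mathcomp Require Import reals.

Set Implicit Arguments.
Unset Strict Implicit.
Unset Printing Implicit Defensive.

Import GRing.Theory.
Local Open Scope ring_scope.

(* A directed graph on the vertices 'I_n is its set of arcs; the pair (i, j)
   is the arc from i to j, and (i, i) is a loop. *)
Definition digraph (n : nat) := {set 'I_n * 'I_n}.

Definition all_loops (n : nat) (E : digraph n) : Prop :=
  forall i : 'I_n, (i, i) \in E.

Definition remove_loops (n : nat) (E : digraph n) : digraph n :=
  [set e in E | e.1 != e.2].

(* The arc (j, i), from j to i, governs the entry of A in row i and column j. *)
Definition Q_ld (R : realType) (n : nat) (E : digraph n) (A : 'M[R]_n) : Prop :=
  forall i j : 'I_n, A i j != 0 <-> (j, i) \in E.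

Definition Q_sd (R : realType) (n : nat) (E : digraph n) (A : 'M[R]_n) : Prop :=
  forall i j : 'I_n, i != j -> (A i j != 0 <-> (j, i) \in E).

Definition input_pattern (R : realType) (n m : nat) (v : 'I_m -> 'I_n)
    (B : 'M[R]_(n, m)) : Prop :=
  forall (i : 'I_n) (j : 'I_m), B i j != 0 <-> i = v j.

(* The n x (n m) block row [B  A B  ...  A^(n-1) B]. *)
Definition ctrb_mx (R : realType) (n m : nat) (A : 'M[R]_n) (B : 'M[R]_(n, m)) :
    'M[R]_(n, \sum_(k < n) m) :=
  \mxrow_(k < n) (A ^+ k *m B).

(* Main.v *)
(* Adding a scalar matrix to A does not change controllability, since the
   powers (A + c I)^j with j <= k are combinations of the A^j with j <= k.  A
   large enough c makes every diagonal entry nonzero and leaves the off-diagonal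
   pattern untouched, so it moves Q_sd (remove_loops E) into Q_ld E. *)

Require Import Defs.
From mathcomp Require Import all_boot all_order all_algebra.
From mathcomp Require Import reals.

Set Implicit Arguments.
Unset Strict Implicit.
Unset Printing Implicit Defensive.

Import Order.TTheory GRing.Theory Num.Theory.

Local Open Scope ring_scope.

(** Full row rank is tested on the left kernel, which is analysed here block by block. *)
Lemma mul_ctrb_mx_eq0 (R : realType) (n m : nat) (A : 'M[R]_n)
    (B : 'M[R]_(n, m)) (u : 'rV[R]_n) :
  u *m ctrb_mx A B = 0 <-> forall k, (k < n)%N -> u *m A ^+ k *m B = 0.
Proof.
rewrite /ctrb_mx mul_mxrow; split=> [u0 k lt_kn | u0].
  have := congr1 (fun M => submxrow M (Ordinal lt_kn)) u0.
  by rewrite mxrowK submxrow0 mulmxA.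
rewrite -[RHS](mxrow0 (q_ := fun=> m)).
by apply: eq_mxrow => k; rewrite mulmxA u0.
Qed.

Lemma mul_shift_exp_eq0 (R : realType) (n m : nat) (A : 'M[R]_n)
    (B : 'M[R]_(n, m)) (c : R) (k : nat) (u : 'rV[R]_n) :
  (forall j, (j <= k)%N -> u *m A ^+ j *m B = 0) ->
  u *m (A + c%:M) ^+ k *m B = 0.
Proof.
elim: k u => [|k IHk] u u0; first exact: (u0 0%N).
(* The induction hypothesis is used for the row [u *m (A + c%:M)]: its product with [A ^+ j *m B] is
   [u *m A ^+ j.+1 *m B] plus [c] times [u *m A ^+ j *m B], and both exponents are at most
   [k.+1]. *)
rewrite exprS -mulmxE mulmxA; apply: IHk => j le_jk.
rewrite mulmxDr mul_mx_scalar !mulmxDl -!scalemxAl u0 ?scaler0 ?addr0 1?ltnW//.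
by rewrite -(mulmxA u) mulmxE -exprS u0.
Qed.

(** The left kernel of [ctrb_mx A B] lies in that of [ctrb_mx (A + c%:M) B], so it is trivial when
    the latter is. *)
Lemma ctrb_mx_shift_row_free (R : realType) (n m : nat) (A : 'M[R]_n)
    (B : 'M[R]_(n, m)) (c : R) :
  row_free (ctrb_mx (A + c%:M) B) -> row_free (ctrb_mx A B).
Proof.
move=> freeAc; apply: inj_row_free => u /mul_ctrb_mx_eq0 u0.
apply: (row_free_inj freeAc); rewrite mul0mx; apply/mul_ctrb_mx_eq0 => k lt_kn.
by apply: mul_shift_exp_eq0 => j le_jk; apply/u0/(leq_ltn_trans le_jk).
Qed.

Lemma exists_shift_neq0 (R : realType) (n : nat) (a : 'I_n -> R) :
  exists c, forall i, a i + c != 0.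
Proof.
(* The sum dominates [- a i], so [a i + c] is at least 1 for all [i] at once. *)
exists (1 + \sum_j `|a j|) => i; apply/lt0r_neq0.
rewrite addrCA ltr_pwDl// (bigD1 i)//= addrA addr_ge0 ?sumr_ge0//.
by rewrite -lerBlDl sub0r (le_trans (ler_norm _))// normrN.
Qed.

Lemma Q_ld_Q_sd (R : realType) (n : nat) (E : digraph n) (A : 'M[R]_n) :
  Q_ld E A -> Q_sd (remove_loops E) A.
Proof.
by move=> QA i j neq_ij; rewrite inE /= (eq_sym j) neq_ij andbT; apply: QA.
Qed.

Lemma Q_sd_shift (R : realType) (n : nat) (E : digraph n) (A : 'M[R]_n)
    (c : R) :
  all_loops E -> Q_sd (remove_loops E) A -> (forall i, A i i + c != 0) ->
  Q_ld E (A + c%:M).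
Proof.
move=> loopsE QA Ac i j; rewrite !mxE.
(* On the diagonal both sides of the equivalence hold: the left by the choice of [c], the right by
   the loops. *)
have [<-|neq_ij] := eqVneq i j; first by rewrite mulr1n Ac loopsE.
by rewrite mulr0n addr0 QA// inE /= (eq_sym j) neq_ij andbT.
Qed.

Theorem theorem6p2 (R : realType) (n m : nat) (E : digraph n)
    (S : {set 'I_n}) (v : 'I_m -> 'I_n)
    (loopsE : all_loops E)
    (v_inj : injective v)
    (S_v : S = [set v j | j : 'I_m]) :
  (forall (A : 'M[R]_n) (B : 'M[R]_(n, m)),
     Q_ld E A -> input_pattern v B -> \rank (ctrb_mx A B) = n)
  <->
  (forall (A : 'M[R]_n) (B : 'M[R]_(n, m)),
     Q_sd (remove_loops E) A -> input_pattern v B -> \rank (ctrb_mx A B) = n).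
Proof.
split=> [ctrl | ctrl] A B QA vB; last exact: ctrl (Q_ld_Q_sd QA) vB.
have [c Ac] := exists_shift_neq0 (fun i => A i i).
(* [row_free] unfolds to [\rank _ == n], so [eqP] passes between it and the rank equations. *)
apply/eqP/(ctrb_mx_shift_row_free (c := c))/eqP.
exact: ctrl (Q_sd_shift loopsE QA Ac) vB.
Qed.
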